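(* Let $X$ be an mm-space with finite diameter. Then, for any real numbers $0 < \kappa < 1$ and $1 \le p < +\infty$ and any natural number $n \ge 1$, we have $$\operatorname{ObsDiam}(X_p^n;-\kappa) \le C_{\kappa,p}\, \operatorname{diam}(X)\, n^{\frac{1}{2p}},$$ where $$C_{\kappa,p} := \begin{cases} 4\sqrt{2\log\frac{2}{\kappa}} & \text{if } p = 1,\\ 4 + 4\sqrt{2\log\frac{2}{\kappa}} & \text{if } 1 < p < +\infty.\end{cases}$$
   Context: An mm-space is a space $X$ equipped with a complete separable metric $d_X$ and a Borel probability measure $\mu_X$ on $X$. $l_p$-product: for $1 \le p < +\infty$ and $n\ge 1$, $X_p^n := (X^n, d_{X_p^n}, \mu_X^{\otimes n})$, where $d_{X_p^n}(x,y) := \left(\sum_{i=1}^n d_X(x_i,y_i)^p\right)^{1/p}$ for $x=(x_1,\dots,x_n), y=(y_1,\dots,y_n)\in X^n$ and $\mu_X^{\otimes n}$ is the product measure. Partial diameter: for an mm-space $X$ and a real number $\alpha$, $\operatorname{diam}(X;\alpha)=\operatorname{diam}(\mu_X;\alpha)$ is the infimum of $\operatorname{diam}(A)$ over all Borel subsets $A\subset X$ with $\mu_X(A)\ge \alpha$. Observable diameter: for $\kappa>0$, $\operatorname{ObsDiam}(X;-\kappa)$ is the supremum of $\operatorname{diam}(f_*\mu_X;1-\kappa)$ over all $1$-Lipschitz functions $f:X\to\mathbb{R}$, where $f_*\mu_X$ is the push-forward measure on $\mathbb{R}$ (with its usual metric). *)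

(* Defs.v *)
From HB Require Import structures.
From mathcomp Require Import all_boot all_order all_algebra.
From mathcomp Require Import all_classical all_reals all_analysis.

Set Implicit Arguments.
Unset Strict Implicit.
Unset Printing Implicit Defensive.

Import Order.TTheory GRing.Theory Num.Theory.
Import numFieldNormedType.Exports.

Local Open Scope classical_set_scope.
Local Open Scope ring_scope.

#[short(type="completeMetricType")]
HB.structure Definition CompleteMetric (K : numDomainType) :=
  {T of Metric K T & CompletePseudoMetric K T}.

Definition separable (T : topologicalType) : Prop :=
  exists2 D : set T, countable D & dense D.

Definition borel (T : ptopologicalType) := g_sigma_algebraType (@open T).

(* The point 0 is adjoined so that the empty set has diameter 0 rather than
   -oo, the supremum of the empty set in \bar R. *)
Definition diam (R : realType) (T : Type) (dist : T -> T -> R) (A : set T)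
    : \bar R :=
  ereal_sup (0%E |` [set (dist x y)%:E | x in A & y in A]).

Definition partial_diam (R : realType) d (T : measurableType d)
    (dist : T -> T -> R) (mu : set T -> \bar R) (alpha : R) : \bar R :=
  ereal_inf [set diam dist A | A in
    [set A : set T | measurable A /\ (alpha%:E <= mu A)%E]].

Definition lip1 (R : realType) (T : Type) (dist : T -> T -> R) (f : T -> R)
    : Prop :=
  forall x y, `|f x - f y| <= dist x y.

(* obs_diam dist mu kappa is ObsDiam((T, dist, mu); - kappa). *)
Definition obs_diam (R : realType) d (T : measurableType d)
    (dist : T -> T -> R) (mu : set T -> \bar R) (kappa : R) : \bar R :=
  ereal_sup [set partial_diam
      (fun x y : measurableTypeR R => `|x - y|)
      (pushforward mu (f : T -> measurableTypeR R)) (1 - kappa)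
    | f in [set f : T -> R | lip1 dist f]].

Definition lp_dist (R : realType) (X : metricType R) (p : R) (n : nat)
    (x y : n.-tuple X) : R :=
  (\sum_(i < n) mdist (tnth x i) (tnth y i) `^ p) `^ p^-1.

Section product_probability.
Context d (T : measurableType d) (R : realType).

Definition tuple_cons n (x : T * n.-tuple T) : n.+1.-tuple T :=
  [tuple of x.1 :: x.2].

Lemma measurable_tuple_cons n : measurable_fun setT (@tuple_cons n).
Proof. exact: measurable_cons. Qed.

HB.instance Definition _ n :=
  isMeasurableFun.Build _ _ _ _ (@tuple_cons n) (@measurable_tuple_cons n).

(* n.-tuple T carries the sigma-algebra generated by the n coordinates. *)
Fixpoint prod_prob (P : probability T R) n : probability (n.-tuple T) R :=
  match n with
  | 0 => @dirac _ (0.-tuple T) [tuple] R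
  | m.+1 => distribution (P \x prod_prob P m)%E (@tuple_cons m)
  end.

Lemma prod_probE (P : probability T R) n (A : 'I_n -> set T) :
  (forall i, measurable (A i)) ->
  prod_prob P n [set x | forall i, A i (tnth x i)] = (\prod_(i < n) P (A i))%E.
Proof.
elim: n A => [|n IHn] A mA.
  rewrite big_ord0 /= diracE mem_set//= => -[].
  by case.
rewrite big_ord_recl /= /distribution /pushforward.
pose B i := A (lift ord0 i).
have mB i : measurable (B i) by exact: mA.
have -> : @tuple_cons n @^-1` [set x | forall i, A i (tnth x i)] =
    A ord0 `*` [set x : n.-tuple T | forall i, B i (tnth x i)].
  apply/seteqP; split => [[a x] /= H|[a x] /= [Ha Hx] i].
    by split=> [|i]; [have := H ord0 | have := H (lift ord0 i); rewrite tnthS].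
  by have [j ->|->//] := unliftP ord0 i; rewrite tnthS; exact: Hx.
have mbox : measurable [set x : n.-tuple T | forall i, B i (tnth x i)].
  have -> : [set x : n.-tuple T | forall i, B i (tnth x i)] =
      \bigcap_(i in [set: 'I_n]) ((@tnth n T)^~ i @^-1` B i).
    by apply/seteqP; split => x /= H i; [move=> _; exact: H | exact: H].
  apply: fin_bigcap_measurable; first exact: finite_finset.
  move=> i _; rewrite -[X in measurable X]setTI.
  by apply: measurable_tnth.
rewrite product_measure1E//; congr (_ * _)%E; exact: IHn.
Qed.

End product_probability.

Definition obs_const (R : realType) (kappa p : R) : R :=
  if p == 1 then 4 * Num.sqrt (2 * ln (2 / kappa))
  else 4 + 4 * Num.sqrt (2 * ln (2 / kappa)).

(* Main.v *)
(* Any f that is 1-Lipschitz for d_p is 1-Lipschitz for d_1, hence measurable by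
   separability. Choose a and b such that {f < a} and {f > b} have mass at most
   kappa / 2 while {f < a + eps} and {f > b - eps} have mass larger than
   kappa / 2; then [a, b] carries mass at least 1 - kappa. To bound b - a, one
   bounds the d_1-distance of two sets A, B of mass at least kappa / 2: if
   nonnegative F, G satisfy F x * G y <= exp (lam * d_1 x y) for all x, y, then
   (\int F) (\int G) <= cosh (lam * D) ^ n, where D = diam X. This tensorizes by
   Fubini, and for n = 1 it follows by symmetrization. With F = 1_A and
   G = exp (lam * r) 1_B, r = d_1(A, B), optimizing in lam gives
   r <= 4 sqrt (2 ln (2 / kappa)) sqrt n D. Finally
   d_p ^ p <= D ^ (p - 1) d_1. *)
Require Import Defs.
From HB Require Import structures.
From mathcomp Require Import all_boot all_order all_algebra.
From mathcomp Require Import all_classical all_reals all_analysis.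
From mathcomp Require Import measurable_realfun ring lra.

Set Implicit Arguments.
Unset Strict Implicit.
Unset Printing Implicit Defensive.

Import Order.TTheory GRing.Theory Num.Theory.
Import numFieldNormedType.Exports.

Local Open Scope classical_set_scope.
Local Open Scope ring_scope.

(** * Elementary real inequalities *)

(** If u >= 1/2, then u <= 2 u^2. Otherwise e^v <= 1/(1 - v) bounds the sum by 2/(1 - u^2), and (1 +
    2 u^2)(1 - u^2) >= 1. *)
Lemma expR_cosh_le (R : realType) (u : R) : 0 <= u ->
  expR u + expR (- u) <= 2 * expR (2 * u ^+ 2).
Proof.
move=> u0; have [u2|u2] := lerP (2^-1) u.
  have h1 : expR u <= expR (2 * u ^+ 2) by rewrite ler_expR; nra.
  have h2 : expR (- u) <= expR (2 * u ^+ 2) by rewrite ler_expR; nra.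
  lra.
have geom (v : R) : v < 1 -> expR v <= (1 - v)^-1.
  move=> v1; rewrite -(opprK v) expRN opprK lef_pV2 ?posrE ?expR_gt0 ?subr_gt0//.
  exact: expR_ge1Dx.
have h1 : expR u <= (1 - u)^-1 by apply: geom; lra.
have h2 : expR (- u) <= (1 - - u)^-1 by apply: geom; lra.
have h3 := expR_ge1Dx (2 * u ^+ 2).
apply: (le_trans (lerD h1 h2)).
have -> : (1 - u)^-1 + (1 - - u)^-1 = 2 / (1 - u ^+ 2).
  by field; rewrite !lt0r_neq0//; nra.
rewrite ler_pdivrMr; last by nra.
have u4 : u ^+ 2 <= 4^-1 by nra.
apply: (@le_trans _ _ (2 * (1 + 2 * u ^+ 2) * (1 - u ^+ 2))).
  by have := sqr_ge0 u; move: (u ^+ 2) u4 => w; nra.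
by rewrite ler_wpM2r ?ler_wpM2l//; lra.
Qed.

(** If the larger term a exceeds C, then b <= C^2/a and a lies in [C/M, C M], where t + C^2/t is
    largest at the endpoints. *)
Lemma addr_le_of_mulr_le (R : realType) (a b C M : R) :
  0 <= a -> 0 <= b -> 0 <= C -> 1 <= M ->
  a <= C * M -> b <= C * M -> a * b <= C ^+ 2 -> a + b <= C * (M + M^-1).
Proof.
move=> a0 b0 C0 M1; have M0 : 0 < M by lra.
wlog ab : a b a0 b0 / b <= a.
  move=> H aM bM abC; case: (lerP b a) => [|/ltW] ab; first exact: H.
  by rewrite addrC H// mulrC.
move=> aM bM abC; have MV : M * M^-1 = 1 by rewrite mulfV ?gt_eqF.
have MV0 : 0 < M^-1 by rewrite invr_gt0.
have [aC|aC] := lerP a C.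
  have : 2 <= M + M^-1 by nra.
  nra.
have a1 : 0 < a by lra.
rewrite -(ler_pM2l a1).
(* Expanded, this reads a^2 + C^2 <= a C (M + 1/M), and a b <= C^2. *)
have h : 0 <= (C * M - a) * (a - C * M^-1).
  apply: mulr_ge0; first lra.
  have : M^-1 <= 1 by nra.
  nra.
have e : (C * M - a) * (a - C * M^-1) = a * (C * (M + M^-1)) - a ^+ 2 - C ^+ 2 * (M * M^-1) by ring.
rewrite e MV in h; nra.
Qed.

(** * Concentration on product spaces *)

Section functional_inequality.
Context d (T : measurableType d) (R : realType).
Local Open Scope ereal_scope.

Lemma adde_le_of_mule_le (a b : \bar R) (C M : R) :
  0 <= a -> 0 <= b -> (0 <= C)%R -> (1 <= M)%R ->
  a <= (C * M)%:E -> b <= (C * M)%:E -> a * b <= (C ^+ 2)%:E ->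
  a + b <= (C * (M + M^-1))%:E.
Proof.
case: a b => [a||] [b||]//; rewrite -?EFinM -?EFinD !lee_fin.
exact: addr_le_of_mulr_le.
Qed.

(* Symmetrizing, [2 (\int F) (\int G)] is the double integral of
   [F x * G y + F y * G x], two quantities whose product is at most [C ^ 2]. *)
Lemma integral_mul_le_cosh (P : probability T R) (F G : T -> \bar R) (C M : R) :
  (0 <= C)%R -> (1 <= M)%R ->
  measurable_fun setT F -> measurable_fun setT G ->
  (forall x, 0 <= F x) -> (forall x, 0 <= G x) ->
  (forall x y, F x * G y <= (C * M)%:E) -> (forall x, F x * G x <= C%:E) ->
  (\int[P]_x F x) * (\int[P]_x G x) <= (C * ((M + M^-1) / 2))%:E.
Proof.
move=> C0 M1 mF mG F0 G0 FGM FGC.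
set a := \int[P]_x F x; set b := \int[P]_x G x.
have a0 : 0 <= a by apply: integral_ge0.
have b0 : 0 <= b by apply: integral_ge0.
set K := (C * (M + M^-1))%R.
have cstP (k : \bar R) : \int[P]_x k = k.
  by rewrite (integral_cst P measurableT k) [X in _ * X]probability_setT mule1.
have pt x : F x * b + G x * a <= K%:E.
  rewrite -ge0_integralZl// -(ge0_integralZl _ measurableT mF)//.
  rewrite -ge0_integralD//=; last 4 first.
  - by move=> y _; exact: mule_ge0.
  - exact: measurable_funeM.
  - by move=> y _; exact: mule_ge0.
  - exact: measurable_funeM.
  rewrite -[leRHS]cstP; apply: ge0_le_integral => //=.
  - by move=> y _; rewrite adde_ge0 ?mule_ge0.
  - by apply: emeasurable_funD; exact: measurable_funeM.
  - move=> y _; apply: adde_le_of_mule_le => //; rewrite ?mule_ge0//.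
    + by rewrite muleC.
    (* Regrouped as [(F x * G x) * (F y * G y)], the product is at most C^2 by the bound on the
       diagonal. *)
    + rewrite muleACA [G y * F y]muleC expr2 EFinM.
      by apply: lee_pmul; rewrite ?mule_ge0.
have mMr H k : measurable_fun setT H -> 0 <= k ->
    measurable_fun setT (fun x : T => H x * k : \bar R).
  move=> mH k0; under eq_fun do rewrite muleC.
  exact: measurable_funeM.
have ab2 : a * b + b * a <= K%:E.
  rewrite -{1}(ge0_integralZr P measurableT mF)// -(ge0_integralZr P measurableT mG)//.
  rewrite -ge0_integralD//=; last 4 first.
  - by move=> y _; exact: mule_ge0.
  - exact: mMr.
  - by move=> y _; exact: mule_ge0.
  - exact: mMr.
  rewrite -[leRHS]cstP; apply: ge0_le_integral => //=.
  - by move=> y _; rewrite adde_ge0 ?mule_ge0.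
  - by apply: emeasurable_funD; exact: mMr.
have : 0 <= a * b by exact: mule_ge0.
move: ab2; rewrite [b * a]muleC /K; case: (a * b) => [r||]//.
by rewrite -EFinD !lee_fin mulrA ler_pdivlMr// => ? _; lra.
Qed.

Lemma prod_probS_integral (P : probability T R) n (F : n.+1.-tuple T -> \bar R) :
  measurable_fun setT F -> (forall x, 0 <= F x) ->
  \int[prod_prob P n.+1]_z F z =
  \int[P]_x \int[prod_prob P n]_y F (tuple_cons (x, y)).
Proof.
move=> mF F0.
rewrite [LHS](ge0_integral_distribution _ mF F0).
rewrite fubini_tonelli1//; last by move=> x; exact: F0.
by apply: measurableT_comp => //; exact: measurable_tuple_cons.
Qed.

(** Induction on n. The constant [c] varies so that, for fixed first coordinates x and y, it absorbs
    the factor exp (lam * dist x y) when the induction hypothesis is applied to the slices. *)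
Lemma prod_prob_integral_mul_le (P : probability T R) (dist : T -> T -> R)
    (D lam : R) n (F G : n.-tuple T -> \bar R) (c : R) :
  (forall x, dist x x = 0)%R -> (forall x y, dist x y <= D)%R ->
  (0 <= D)%R -> (0 <= lam)%R -> (0 <= c)%R ->
  measurable_fun setT F -> measurable_fun setT G ->
  (forall x, 0 <= F x) -> (forall x, 0 <= G x) ->
  (forall x y, F x * G y <=
    (c * expR (lam * \sum_(i < n) dist (tnth x i) (tnth y i)))%:E) ->
  (\int[prod_prob P n]_x F x) * (\int[prod_prob P n]_x G x) <=
    (c * expR (2 * (lam * D) ^+ 2 *+ n))%:E.
Proof.
move=> dist0 distD D0 lam0.
elim: n F G c => [|n IH] F G c c0 mF mG F0 G0 FG.
  rewrite !integral_dirac// !diracT !mul1e.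
  by apply: (le_trans (FG _ _)); rewrite big_ord0 mulr0 mulr0n expR0.
rewrite !prod_probS_integral//.
have mcons (H : n.+1.-tuple T -> \bar R) : measurable_fun setT H ->
    measurable_fun setT (H \o @tuple_cons _ T n).
  by move=> mH; apply: measurableT_comp => //; exact: measurable_tuple_cons.
have mcons2 x (H : n.+1.-tuple T -> \bar R) : measurable_fun setT H ->
    measurable_fun setT (fun y => H (tuple_cons (x, y))).
  by move=> mH; exact: (measurable_fun_pair2 x (mcons _ mH)).
have mint (H : n.+1.-tuple T -> \bar R) : measurable_fun setT H ->
    (forall z, 0 <= H z) ->
    measurable_fun setT (fun x => \int[prod_prob P n]_y H (tuple_cons (x, y))).
  move=> mH H0.
  exact: (@measurable_fun_fubini_tonelli_F _ _ _ _ _ (prod_prob P n)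
    (H \o @tuple_cons _ T n) (mcons _ mH) (fun z => H0 _)).
have key x y : \int[prod_prob P n]_z F (tuple_cons (x, z)) *
    \int[prod_prob P n]_z G (tuple_cons (y, z)) <=
    (c * expR (lam * dist x y) * expR (2 * (lam * D) ^+ 2 *+ n))%:E.
  apply: IH => //.
  - by rewrite mulr_ge0 ?expR_ge0.
  - exact: mcons2.
  - exact: mcons2.
  - move=> x' y'; apply: (le_trans (FG _ _)).
    rewrite big_ord_recl /= mulrDr expRD mulrA lee_fin.
    rewrite le_eqVlt; apply/orP; left; apply/eqP; congr (_ * expR (_ * _))%R.
    by apply: eq_bigr => i _; rewrite !tnthS.
set E := expR (2 * (lam * D) ^+ 2 *+ n).
(* The one-coordinate inequality with C = c E and M = exp (lam D): [dist x y <= D] gives the bound C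
   M, and [dist x x = 0] gives C on the diagonal. *)
apply: (@le_trans _ _ (c * E * ((expR (lam * D) + (expR (lam * D))^-1) / 2))%:E).
  apply: integral_mul_le_cosh.
  - by rewrite mulr_ge0 ?expR_ge0.
  - by rewrite -expR0 ler_expR mulr_ge0.
  - exact: (mint _ mF F0).
  - exact: (mint _ mG G0).
  - by move=> x; exact: integral_ge0.
  - by move=> x; exact: integral_ge0.
  - move=> x y; apply: (le_trans (key x y)); rewrite lee_fin mulrAC.
    by rewrite ler_wpM2l ?mulr_ge0 ?expR_ge0// ler_expR ler_wpM2l.
  - move=> x; apply: (le_trans (key x x)).
    by rewrite dist0 mulr0 expR0 mulr1.
rewrite lee_fin -mulrA ler_wpM2l// [(_ *+ n.+1)%R]mulrS expRD -/E [leRHS]mulrC.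
rewrite ler_wpM2l ?expR_ge0// ler_pdivrMr// -expRN [leRHS]mulrC.
by rewrite expR_cosh_le// mulr_ge0.
Qed.

End functional_inequality.

(** For every lam >= 0, k^2 exp (lam r) <= exp (2 n lam^2 D^2); taking logarithms leaves a quadratic
    in lam to optimize. *)
Lemma prod_prob_separation d (T : measurableType d) (R : realType)
    (P : probability T R) (dist : T -> T -> R) (D : R) n
    (A B : set (n.-tuple T)) (k r : R) :
  (forall x, dist x x = 0) -> (forall x y, dist x y <= D) -> 0 <= D ->
  measurable A -> measurable B -> 0 < k -> 0 <= r ->
  (k%:E <= prod_prob P n A)%E -> (k%:E <= prod_prob P n B)%E ->
  (forall x y, A x -> B y -> r <= \sum_(i < n) dist (tnth x i) (tnth y i)) ->
  r ^+ 2 <= 16 * ln k^-1 * n%:R * D ^+ 2.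
Proof.
move=> dist0 distD D0 mA mB k0 r0 kA kB AB.
have main lam : 0 <= lam -> lam * r <= 2 * ln k^-1 + 2 * lam ^+ 2 * (n%:R * D ^+ 2).
  move=> lam0.
  pose F x : \bar R := (\1_A x)%:E.
  pose G x : \bar R := ((expR (lam * r))%:E * (\1_B x)%:E)%E.
  have mF : measurable_fun setT F.
    by apply/measurable_EFinP; exact: measurable_indic.
  have mB1 : measurable_fun setT (fun x => (\1_B x)%:E : \bar R).
    by apply/measurable_EFinP; exact: measurable_indic.
  have mG : measurable_fun setT G by exact: measurable_funeM.
  have F0 x : (0 <= F x)%E by rewrite lee_fin.
  have G0 x : (0 <= G x)%E by rewrite mule_ge0// lee_fin ?expR_ge0.
  have FG x y : (F x * G y <=
      (1 * expR (lam * \sum_(i < n) dist (tnth x i) (tnth y i)))%:E)%E.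
    rewrite /F /G -!EFinM lee_fin mul1r !indicE.
    have [/set_mem Ax|_] := boolP (x \in A); last by rewrite mul0r expR_ge0.
    have [/set_mem By|_] := boolP (y \in B); last by rewrite !mulr0 expR_ge0.
    by rewrite mul1r mulr1 ler_expR ler_wpM2l// AB.
  have := prod_prob_integral_mul_le P dist0 distD D0 lam0 ler01 mF mG F0 G0 FG.
  rewrite /F integral_indic// /G ge0_integralZl//.
  rewrite integral_indic// !setIT mul1r => h.
  have : ((k * (expR (lam * r) * k))%:E <= (expR (2 * (lam * D) ^+ 2 *+ n))%:E)%E.
    apply: le_trans h; rewrite !EFinM; apply: lee_pmul => //.
    - by rewrite lee_fin ltW.
    - by rewrite mule_ge0// lee_fin ?expR_ge0 ?ltW.
    - by apply: lee_wpmul2l => //; rewrite lee_fin expR_ge0.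
  rewrite lee_fin -ler_ln ?posrE ?mulr_gt0 ?expR_gt0//.
  rewrite !lnM ?posrE ?mulr_gt0 ?expR_gt0// !expRK lnV ?posrE//.
  rewrite -mulr_natr exprMn; move: (D ^+ 2) (lam ^+ 2) n%:R => D2 l2 m.
  lra.
set L := ln k^-1 in main *; set a := n%:R * D ^+ 2 in main *.
rewrite -mulrA -/a.
have a0 : 0 <= a by rewrite mulr_ge0// sqr_ge0.
have L0 : 0 <= L by have := main 0 (lexx _); rewrite mul0r expr0n/= mulr0 mul0r; lra.
(* If a = 0, then lam r <= 2 L for all lam >= 0, which forces r = 0. *)
move: a0; rewrite le_eqVlt => /predU1P[a0|a0].
  rewrite -a0 mulr0; have [r1|] := lerP r 0.
    have -> : r = 0 by lra.
    by rewrite expr0n.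
  move=> r1; have := main ((2 * L + 1) / r) _; rewrite divr_ge0//; last lra.
  move=> /(_ isT); rewrite -a0 mulr0 divfK ?gt_eqF//; lra.
(* This lam maximizes lam r - 2 lam^2 a; the maximum is r^2 / (8 a). *)
have := main (r / (4 * a)) _; rewrite divr_ge0//; last lra.
move=> /(_ isT); have -> : r / (4 * a) * r = r ^+ 2 / (8 * a) * 2 by field; lra.
have -> : 2 * (r / (4 * a)) ^+ 2 * a = r ^+ 2 / (8 * a) by field; lra.
move=> h; have : r ^+ 2 / (8 * a) <= 2 * L by lra.
by rewrite ler_pdivrMr; lra.
Qed.

(** * Comparison of the l_p and l_1 distances *)

Section powers.
Context (R : realType).
Implicit Types (a b p : R).

Lemma powR_le_mul a b p : 1 <= p -> 0 <= a -> a <= b ->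
  a `^ p <= a * b `^ (p - 1).
Proof.
move=> p1 a0 ab; rewrite -mulr_powRB1//; last lra.
by rewrite ler_wpM2l// ge0_ler_powR ?nnegrE//; lra.
Qed.

(** With b the diameter D this gives d_p^p <= D^(p-1) d_1; with b the sum itself it gives d_p <=
    d_1. *)
Lemma sum_powR_le n (a : 'I_n -> R) b p : 1 <= p ->
  (forall i, 0 <= a i) -> (forall i, a i <= b) ->
  \sum_(i < n) a i `^ p <= (\sum_(i < n) a i) * b `^ (p - 1).
Proof.
by move=> p1 a0 ab; rewrite mulr_suml; apply: ler_sum => i _; exact: powR_le_mul.
Qed.

Lemma powRVK a p : 0 <= a -> p != 0 -> (a `^ p) `^ p^-1 = a.
Proof. by move=> a0 p0; rewrite -powRrM divff// powRr1. Qed.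

Lemma lp_dist_le_sum (X : metricType R) p n (x y : n.-tuple X) : 1 <= p ->
  lp_dist p x y <= \sum_(i < n) mdist (tnth x i) (tnth y i).
Proof.
move=> p1; set S := \sum_(i < n) _.
have S0 : 0 <= S by apply: sumr_ge0 => i _; exact: mdist_ge0.
rewrite -(powRVK S0 (p := p)); last by lra.
rewrite ge0_ler_powR ?nnegrE ?invr_ge0 ?powR_ge0//; first lra.
  by apply: sumr_ge0 => i _; exact: powR_ge0.
rewrite -[leRHS]mulr_powRB1//; last lra.
apply: sum_powR_le => // i; first exact: mdist_ge0.
rewrite /S (bigD1 i)//= lerDl; apply: sumr_ge0 => j _; exact: mdist_ge0.
Qed.

(** For p > 1, s^(1/p) <= max (1, s); the additive 4 in the constant absorbs the case s < 1. *)
Lemma powR_inv_le_const kappa p : 1 <= p ->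
  (4 * Num.sqrt (2 * ln (2 / kappa))) `^ p^-1 <= obs_const kappa p.
Proof.
rewrite /obs_const; set s := 4 * _ => p1; have s0 : 0 <= s by rewrite mulr_ge0 ?sqrtr_ge0.
have [->|pN1] := eqVneq p 1; first by rewrite invr1 powRr1.
have pV : p^-1 <= 1 by rewrite invf_le1; lra.
have pV0 : 0 <= p^-1 by rewrite invr_ge0; lra.
have [s1|s1] := lerP 1 s; first by have := ler1_powR s1 pV; lra.
have : s `^ p^-1 <= 1 `^ p^-1 by rewrite ge0_ler_powR ?nnegrE//; lra.
by rewrite powR1; lra.
Qed.

End powers.

(** * Approximate quantiles of bounded functions *)

(** Otherwise P {f < t} <= k would propagate in steps of e from t = -M, where the set is empty, to
    beyond M, where it has mass 1 > k. *)
Lemma exists_quantile d (T : measurableType d) (R : realType)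
    (P : probability T R) (f : T -> R) (M k e : R) :
  (forall x, `|f x| <= M) -> 0 <= k -> k < 1 -> 0 < e ->
  exists t, (P [set x | (f x < t)%R] <= k%:E)%E /\
    (k%:E < P [set x | (f x < t + e)%R])%E.
Proof.
move=> fM k0 k1 e0; apply: contrapT => noq.
have step j : (P [set x | (f x < - M + j%:R * e)%R] <= k%:E)%E.
  elim: j => [|j IH].
    rewrite (_ : [set x | _] = set0) ?measure0 ?lee_fin// -subset0 => x /=.
    by have := fM x; rewrite ler_norml mul0r addr0 => /andP[]; lra.
  rewrite leNgt; apply/negP => h; apply: noq.
  by exists (- M + j%:R * e); split=> //; move: h; rewrite -natr1 mulrDl mul1r addrA.
have [j Mj] : exists j : nat, 2 * M / e < j%:R.
  exists (Num.truncn (2 * M / e)).+1; exact: truncnS_gt.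
have := step j; rewrite (_ : [set x | _] = setT).
  by rewrite probability_setT lee_fin; lra.
apply/seteqP; split=> // x _ /=.
by move: Mj; rewrite ltr_pdivrMr//; have := fM x; rewrite ler_norml => /andP[]; lra.
Qed.

Lemma measurable_preimage_itv d (T : measurableType d) (R : realType)
    (f : T -> R) (I : interval R) :
  measurable_fun [set: T] (f : T -> measurableTypeR R) ->
  measurable [set x | f x \in I].
Proof.
move=> mf; rewrite -[X in measurable X]setTI.
exact: (mf measurableT [set` I] (measurable_itv I)).
Qed.

Lemma lp_distK (R : realType) (X : metricType R) (p : R) n (x y : n.-tuple X) :
  p != 0 -> lp_dist p x y `^ p = \sum_(i < n) mdist (tnth x i) (tnth y i) `^ p.
Proof.
move=> p0; rewrite /lp_dist -powRrM mulVf// powRr1//.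
by apply: sumr_ge0 => i _; exact: powR_ge0.
Qed.

(** * Measurability of Lipschitz functions on the product *)

Section measurability.
Context (R : realType) (X : completeMetricType R).

Lemma separable_dense_sequence : separable X ->
  exists e : nat -> X, forall x (eps : R), 0 < eps ->
    exists k, mdist x (e k) < eps.
Proof.
move=> [D /pcard_surjP[g gD] denseD]; exists g => x eps eps0.
have [||y [/interior_subset xy Dy]] := denseD (ball x eps)°.
- by exists x; exact: nbhsx_ballx.
- exact: open_interior.
have [k _ gk] := gD y Dy.
by exists k; rewrite gk; move: xy; rewrite ballEmdist.
Qed.

Lemma measurable_mdistl (x : X) :
  measurable_fun [set: borel X] (fun y : borel X => mdist (y : X) x : measurableTypeR R).
Proof.
apply: (measurability _ (RGenInftyO.measurableE R)) => //= _ [_ [c ->] <-].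
rewrite setTI; apply: sub_sigma_algebra => /=.
rewrite openE => y /=; rewrite in_itv/= => yc.
apply/nbhs_ballP; exists (c - mdist y x); first by rewrite /= subr_gt0.
move=> z; rewrite ballEmdist /= in_itv/= => yz.
by have := metric_triangle z y x; rewrite (metric_sym z y); lra.
Qed.

(* By density of the sequence [e], the open sublevel set [f < c] is the union
   over [q : n.-tuple nat] of the sets [f (e q) + d_1 (x, e q) < c]. *)
Lemma lipschitz_measurable n (f : n.-tuple X -> R) : separable X ->
  (forall x y, `|f x - f y| <= \sum_(i < n) mdist (tnth x i) (tnth y i)) ->
  measurable_fun [set: n.-tuple (borel X)] (f : n.-tuple (borel X) -> measurableTypeR R).
Proof.
move=> /separable_dense_sequence[e edense] lipf.
apply: (measurability _ (RGenInftyO.measurableE R)) => //= _ [_ [c ->] <-].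
rewrite setTI.
pose g (q : n.-tuple nat) : n.-tuple X := map_tuple e q.
pose h (q : n.-tuple nat) (x : n.-tuple (borel X)) : R :=
  \sum_(i < n) mdist (tnth x i : X) (tnth (g q) i).
(* A sum of functions of single coordinates is measurable for the sigma-algebra that the coordinates
   generate. *)
have mh q : measurable_fun [set: n.-tuple (borel X)] (h q : _ -> measurableTypeR R).
  apply: measurable_sum => i.
  apply: (measurableT_comp (measurable_mdistl (tnth (g q) i))).
  exact: measurable_tnth.
have -> : f @^-1` `]-oo, c[ =
    \bigcup_q [set x : n.-tuple (borel X) | h q x < c - f (g q)].
  apply/seteqP; split => x /=; rewrite in_itv/=; last first.
    move=> [q _ /= hq]; have := lipf x (g q); rewrite ler_norml => /andP[_].
    by rewrite -/(h q x); lra.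
  (* Both h <= n eps and f (e q) <= f x + n eps will hold, so their sum stays below c; [n.+1] keeps
     the denominator nonzero when n = 0. *)
  move=> fc; pose eps := (c - f x) / (2 * n.+1%:R).
  have eps0 : 0 < eps by rewrite divr_gt0 ?subr_gt0.
  have /choice[k ek] := fun i : 'I_n => edense (tnth x i) eps eps0.
  exists [tuple k i | i < n] => //=.
  set q := [tuple _ | _ < _].
  have hq : h q x <= n%:R * eps.
    rewrite /h mulr_natl -[n in _ *+ n]card_ord -sumr_const; apply: ler_sum => i _.
    by rewrite tnth_map tnth_mktuple ltW.
  have := lipf x (g q); rewrite ler_norml => /andP[+ _].
  rewrite -/(h q x).
  have : (2 * n.+1%:R) * eps = c - f x by rewrite mulrC divfK.
  by rewrite -natr1; lra.
apply: countable_bigcupT_measurable => // q.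
have := measurable_preimage_itv `]-oo, c - f (g q)[ (mh q).
by under eq_set do rewrite in_itv/=.
Qed.

End measurability.

(** * Observable diameter of the l_p-product *)

Theorem theorem1p1 (R : realType) (X : completeMetricType R)
    (sepX : separable X) (mu : probability (borel X) R)
    (finX : (diam (@mdist R X) [set: X] < +oo)%E)
    (kappa p : R) (n : nat)
    (kappa0 : 0 < kappa) (kappa1 : kappa < 1) (p1 : 1 <= p) (n1 : (1 <= n)%N) :
  (obs_diam (T := n.-tuple (borel X)) (@lp_dist R X p n) (prod_prob mu n) kappa
   <= (obs_const kappa p)%:E * diam (@mdist R X) [set: X]
      * (n%:R `^ (2 * p)^-1)%:E)%E.
Proof.
have p0 : p != 0 by rewrite gt_eqF// (lt_le_trans ltr01).
have diam0 : (0 <= diam (@mdist R X) [set: X])%E by apply: ereal_sup_ubound; left.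
have [D DE] : exists D : R, diam (@mdist R X) [set: X] = D%:E.
  by exists (fine (diam (@mdist R X) [set: X])); rewrite fineK// ge0_fin_numE.
have D0 : 0 <= D by rewrite -lee_fin -DE.
have distD (x y : X) : mdist x y <= D.
  by rewrite -lee_fin -DE; apply: ereal_sup_ubound; right; exists x => //; exists y.
rewrite DE -!EFinM; apply: ge_ereal_sup => _ [f lipf <-].
set bound := _ * _ * _.
have bound0 : 0 <= bound.
  by rewrite !mulr_ge0 ?powR_ge0//; apply: le_trans (powR_inv_le_const _ p1); rewrite powR_ge0.
(* The quantiles are only approximate, so an arbitrary loss [e] is allowed, half of it at each
   end. *)
apply/lee_addgt0Pr => e e0; rewrite -EFinD.
have lip1f x y : `|f x - f y| <= \sum_(i < n) mdist (tnth x i) (tnth y i).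
  exact: le_trans (lipf x y) (lp_dist_le_sum _ _ p1).
have mf := lipschitz_measurable sepX lip1f.
set Q := prod_prob mu n.
have sumD x y : \sum_(i < n) mdist (tnth x i : X) (tnth y i) <= n%:R * D.
  by rewrite mulr_natl -[n in _ *+ n]card_ord -sumr_const; exact: ler_sum.
pose x0 : n.-tuple X := [tuple point | i < n].
have fM x : `|f x| <= `|f x0| + n%:R * D.
  rewrite -[f x](subrK (f x0)) addrC; apply: (le_trans (ler_normD _ _)).
  by rewrite lerD2l (le_trans (lip1f _ _)).
have fNM x : `|- f x| <= `|f x0| + n%:R * D by rewrite normrN.
have k0 : 0 < kappa / 2 by lra.
have k1 : kappa / 2 < 1 by lra.
have e2 : 0 < e / 2 by lra.
have [a [Qa Qa']] := exists_quantile Q fM (ltW k0) k1 e2.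
(* A quantile of [- f]: the upper end of the interval is [- b]. *)
have [b [Qb Qb']] := exists_quantile Q fNM (ltW k0) k1 e2.
have mlt c : measurable [set x : n.-tuple (borel X) | f x < c].
  have := measurable_preimage_itv `]-oo, c[ mf.
  by under eq_set do rewrite in_itv/=.
have mNlt c : measurable [set x : n.-tuple (borel X) | - f x < c].
  have := measurable_preimage_itv `](- c), +oo[ mf.
  by under eq_set do rewrite in_itv/= andbT ltrNl.
have gap : - b - a <= bound + e.
  rewrite -lerBlDr.
  have [|d0] := lerP (- b - a - e) 0; first by move=> /le_trans; apply.
  set dl := _ - e in d0 *.
  have sepAB x y : f x < a + e / 2 -> - f y < b + e / 2 -> dl <= lp_dist p x y.
    move=> fx fy; apply: le_trans (lipf x y).
    by rewrite distrC (le_trans _ (ler_norm _))// /dl; lra.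
  have nonempty (g : n.-tuple X -> R) c : (0 < Q [set x | (g x < c)%R])%E -> exists x, g x < c.
    move=> Q0; suff /set0P : [set x | g x < c] != set0 by [].
    by apply: contraTneq Q0 => ->; rewrite measure0 ltxx.
  have k0E : (0 < (kappa / 2)%:E)%E by rewrite lte_fin.
  have [x1 fx1] := nonempty f _ (lt_trans k0E Qa').
  have [y1 fy1] := nonempty (fun x => - f x) _ (lt_trans k0E Qb').
  (* Both sets have positive mass, hence contain points at distance at least [dl] > 0. Positivity of
     D permits dividing by D^(p-1) below. *)
  have Dgt0 : 0 < D.
    rewrite lt_neqAle D0 andbT; apply/eqP => D00.
    have := le_trans (sepAB _ _ fx1 fy1) (le_trans (lp_dist_le_sum x1 y1 p1) (sumD x1 y1)).
    by rewrite -D00 mulr0; lra.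
  (* By d_p^p <= D^(p-1) d_1, sets at d_p-distance at least [dl] are at d_1-distance at least
     [r]. *)
  pose r := dl `^ p / D `^ (p - 1).
  have r0 : 0 <= r by rewrite divr_ge0 ?powR_ge0.
  have sep1 x y : f x < a + e / 2 -> - f y < b + e / 2 ->
      r <= \sum_(i < n) mdist (tnth x i) (tnth y i).
    move=> fx fy; rewrite ler_pdivrMr ?powR_gt0//.
    apply: (@le_trans _ _ (lp_dist p x y `^ p)).
      apply: ge0_ler_powR; rewrite ?nnegrE ?powR_ge0 ?(ltW d0) ?sepAB//.
      by lra.
    rewrite lp_distK//.
    by apply: sum_powR_le => // i; exact: mdist_ge0.
  have := prod_prob_separation (P := mu) (@mdistxx _ X) distD D0 (mlt _) (mNlt _)
    k0 r0 (ltW Qa') (ltW Qb') sep1.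
  rewrite invf_div => r2.
  set s := 4 * Num.sqrt (2 * ln (2 / kappa)).
  have L0 : 0 <= ln (2 / kappa) by rewrite ln_ge0// ler_pdivlMr//; lra.
  have s0 : 0 <= s by rewrite mulr_ge0 ?sqrtr_ge0.
  (* Here s^2 = 32 ln (2 / kappa), twice the constant that the separation bound provides. *)
  have rs : r <= s * Num.sqrt n%:R * D.
    rewrite -ler_sqr ?nnegrE ?r0 ?mulr_ge0 ?sqrtr_ge0//; apply: (le_trans r2).
    rewrite !exprMn !sqr_sqrtr ?mulr_ge0// ler_wpM2r ?sqr_ge0// ler_wpM2r//.
    lra.
  have dlp : dl `^ p <= s * Num.sqrt n%:R * D `^ p.
    rewrite -(@mulr_powRB1 _ D p)//; last lra.
    by rewrite mulrA -ler_pdivrMr ?powR_gt0.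
  (* Taking p-th roots turns sqrt n into n^(1/(2p)) and s into s^(1/p). *)
  rewrite -[leLHS](powRVK (ltW d0) p0).
  apply: (@le_trans _ _ ((s * Num.sqrt n%:R * D `^ p) `^ p^-1)).
    by rewrite ge0_ler_powR ?nnegrE ?invr_ge0 ?mulr_ge0 ?sqrtr_ge0 ?powR_ge0//; lra.
  rewrite powRM ?mulr_ge0 ?sqrtr_ge0 ?powR_ge0// powRVK// [(s * _) `^ _]powRM ?sqrtr_ge0//.
  rewrite -(powR12_sqrt (ler0n R n)) -powRrM -invfM mulrAC.
  by rewrite !ler_wpM2r ?powR_ge0// powR_inv_le_const.
apply: (@le_trans _ _ (diam (fun x y : measurableTypeR R => `|x - y|) `[a, - b]%classic)).
  apply: ereal_inf_lbound; exists `[a, - b]%classic => //; split.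
    exact: measurable_itv.
  rewrite /pushforward.
  (* The two tails outside [[a, - b]], each of mass at most kappa / 2. *)
  set B := [set x | f x < a] `|` [set x | - f x < b].
  have -> : f @^-1` `[a, - b] = ~` B.
    apply/seteqP; split => x /=; rewrite in_itv/=.
      by move=> /andP[af fb] [/=|/=]; lra.
    by move=> /not_orP[/negP + /negP]; rewrite -!leNgt => -> ?; lra.
  have mB : measurable B by exact: measurableU.
  rewrite [leRHS]probability_setC// EFinB leeB//.
  apply: (le_trans (measureU2 _ _ _)) => //.
  by rewrite [kappa]splitr EFinD leeD.
(* The first case is the value 0 adjoined in [diam]; it is covered by [bound0]. *)
apply: ge_ereal_sup => _ [->|[x xab [y yab <-]]]; rewrite lee_fin; first by lra.
move: xab yab; rewrite /= !in_itv/= => /andP[? ?] /andP[? ?].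
by rewrite ler_norml; lra.
Qed.
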